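(* Let $\mathcal{Q}(C)$ be a covering polyhedron and let $\mathcal{F}=\{I_n\}_{n=0}^\infty$ be its associated filtration. Then $\alpha_{\mathcal{F}}(1)\geq\widehat{\alpha}(\mathcal{F})$, with equality if $\mathcal{Q}(C)$ is integral.
   Context: $S=K[t_1,\ldots,t_s]$ is a polynomial ring over a field $K$, $\mathbb{N}=\{0,1,\ldots\}$, $t^a=t_1^{a_1}\cdots t_s^{a_s}$ for $a\in\mathbb{N}^s$; vector inequalities are componentwise and $1$ also denotes $(1,\ldots,1)$. A covering polyhedron is a polyhedron $\mathcal{Q}(C)=\{x\in\mathbb{R}^s\mid x\geq 0;\ xC\geq 1\}$ ($x$ a row vector), where $C$ is an $s\times m$ matrix with non-negative rational entries and non-zero columns; it is integral if all its vertices have integer entries. Its associated filtration is $I_0=S$ and, for $n\geq 1$, $I_n$ the ideal generated by all monomials $t^a$, $a\in\mathbb{N}^s$, with $a/n\in\mathcal{Q}(C)$. For $n\geq 1$, $\alpha_{\mathcal{F}}(n)$ is the least degree of a monomial in $I_n$, and the Waldschmidt constant of $\mathcal{F}$ is $\widehat{\alpha}(\mathcal{F})=\lim_{n\to\infty}\alpha_{\mathcal{F}}(n)/n$ (this limit exists and equals $\inf_{n\geq 1}\alpha_{\mathcal{F}}(n)/n$). *)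

(* Defs.v *)
From mathcomp Require Import all_boot all_order all_algebra.
From mathcomp Require Import boolp classical_sets reals filter topology.
From mathcomp Require Import normedtype sequences.
(* The notations of mpoly clash with those of MathComp-Analysis. *)
From mathcomp Require Import -(notations) mpoly.
Import numFieldNormedType.Exports.

Set Implicit Arguments.
Unset Strict Implicit.
Unset Printing Implicit Defensive.

Import Order.TTheory GRing.Theory Num.Theory.

Local Open Scope classical_set_scope.
Local Open Scope ring_scope.

Section Polyhedra.
Variables (R : realType) (s : nat).

Definition covering_matrix (m : nat) (C : 'M[rat]_(s, m)) : Prop :=
  (forall i j, 0 <= C i j) /\ (forall j, col j C != 0).

Definition covering_polyhedron (m : nat) (C : 'M[rat]_(s, m)) : set 'rV[R]_s :=
  [set x : 'rV[R]_s | (forall i, 0 <= x 0 i) /\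
           (forall j, 1 <= (x *m map_mx ratr C) 0 j)].

(* A vertex is a face of dimension 0: [set x] is the set of points of Q at
   which a linear inequality [y *m c >= b] valid on Q is an equality. *)
Definition vertex (Q : set 'rV[R]_s) (x : 'rV[R]_s) : Prop :=
  exists (c : 'cV[R]_s) (b : R),
    (forall y, Q y -> b <= (y *m c) 0 0) /\
    Q `&` [set y : 'rV[R]_s | (y *m c) 0 0 = b] = [set x].

Definition integral_polyhedron (Q : set 'rV[R]_s) : Prop :=
  forall x, vertex Q x -> forall i, x 0 i \is a Num.int.

End Polyhedra.

Arguments covering_polyhedron R {s m} C _.

Section Filtrations.
Variables (K : fieldType) (s : nat).

Definition is_ideal (A : comNzRingType) (J : set A) : Prop :=
  [/\ J 0, (forall f g, J f -> J g -> J (f + g))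
         & (forall h f, J f -> J (h * f))].

Definition ideal_generated (A : comNzRingType) (G : set A) : set A :=
  smallest (@is_ideal A) G.

Definition filtration (R : realType) (m : nat) (C : 'M[rat]_(s, m)) (n : nat) :
    set (mpoly s K) :=
  if n is 0%N then setT else
  ideal_generated
    [set mpolyX K a | a in
      [set a : multinom s |
        covering_polyhedron R C (\row_i ((a i)%:R / n%:R))]].

(* The default value 0 is only taken when [I n] contains no monomial, which does
   not happen for the ideals of [filtration K R C] with [covering_matrix C]. *)
Definition alpha (I : nat -> set (mpoly s K)) (n : nat) : nat :=
  let degrees := [set mdeg a | a in [set a : multinom s | I n (mpolyX K a)]] in
  xget 0%N [set d | degrees d /\ forall d', degrees d' -> (d <= d')%N].

Definition waldschmidt (R : realType) (I : nat -> set (mpoly s K)) : R :=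
  lim ((fun n : nat => (alpha I n)%:R / n%:R : R) @ \oo).

End Filtrations.

Arguments filtration K {s} R {m} C n _.
Arguments waldschmidt {K s} R I.

(* Main.v *)
Require Import Defs.
From mathcomp Require Import all_boot all_order all_algebra.
From mathcomp Require Import boolp classical_sets reals filter topology.
From mathcomp Require Import normedtype sequences.
From mathcomp Require Import -(notations) mpoly.
From mathcomp Require Import ring lra.
Import numFieldNormedType.Exports.

Set Implicit Arguments.
Unset Strict Implicit.
Unset Printing Implicit Defensive.

Import Order.TTheory GRing.Theory Num.Theory.
Local Open Scope ring_scope.

(** Both claims compare numbers with [lp_value], the infimum of the coordinate
    sum [|x|] over the covering polyhedron [Q].

    A monomial [t^a] lies in [I_n] exactly when [a / n] is in [Q]
    ([filtration_monomial]: [Q] is closed upwards, so multiples of generators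
    are generators).  Hence [alpha n / n] is the least [|a / n|] among the
    points [a / n] of [Q], and it is at least [lp_value].  Conversely, for [x]
    in [Q], rounding [n x] up to an integer vector gives an exponent of [I_n]
    of degree at most [n |x| + s], so [alpha n / n <= |x| + s / n].  Letting
    [n] grow and [|x|] approach the infimum, [alpha n / n] converges to
    [lp_value] ([waldschmidtE]); in particular the Waldschmidt constant is at
    most [alpha 1].

    For the equality, every [x] in [Q] dominates in coordinate sum some vertex
    [v] of [Q] ([vertex_below]).  If [Q] is integral, [v] is itself an exponent
    of [I_1], so [alpha 1 <= |v| <= |x|] ([alpha1_le_vertex]); taking the
    infimum over [x], [alpha 1 <= lp_value].  The vertex is found as in
    the simplex method: as long as the tight inequalities at [x] leave some
    line free, move along it in the direction that does not increase the
    objective until a further inequality becomes tight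
    ([descend_to_vertex]). *)

(** * Vertices of polyhedra given by inequalities *)

Section Vertices.
Variables (R : realType) (s p : nat) (A : 'M[R]_(s, p)) (b : 'rV[R]_p).

Definition polyhedron : set 'rV[R]_s :=
  [set y | forall k, b 0 k <= (y *m A) 0 k]%classic.

Definition slack (x : 'rV[R]_s) (k : 'I_p) : R := (x *m A) 0 k - b 0 k.

Lemma slackD (x d : 'rV[R]_s) (t : R) k :
  slack (x + t *: d) k = slack x k + t * (d *m A) 0 k.
Proof. by rewrite /slack mulmxDl -scalemxAl !mxE addrAC. Qed.

Lemma slack_ge0 x : polyhedron x <-> forall k, 0 <= slack x k.
Proof. by split=> h k; move: (h k); rewrite /slack subr_ge0. Qed.

(** The sum of the tight inequalities at [x] is a valid inequality; a point of
    the polyhedron where it is an equality makes each of them tight, hence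
    differs from [x] by a vector that they all annihilate.  So this single
    inequality exposes [x] as a face. *)
Lemma vertex_of_rigid x : polyhedron x ->
  (forall d : 'rV[R]_s, (forall k, slack x k = 0 -> (d *m A) 0 k = 0) -> d = 0) ->
  vertex polyhedron x.
Proof.
move=> Px rigid.
pose act := [pred k | slack x k == 0].
pose c : 'cV[R]_s := \sum_(k | act k) col k A.
have cE y : (y *m c) 0 0 - \sum_(k | act k) b 0 k = \sum_(k | act k) slack y k.
  rewrite sumrB; congr (_ - _).
  rewrite /c mulmx_sumr summxE; apply: eq_bigr => k _.
  by rewrite colE mulmxA -colE mxE.
exists c, (\sum_(k | act k) b 0 k); split=> [y /slack_ge0 Py|].
  by rewrite -subr_ge0 cE sumr_ge0.
apply/seteqP; split=> [y [/slack_ge0 Py /= yb]|_ ->].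
  have: \sum_(k | act k) slack y k = 0 by rewrite -cE yb subrr.
  move/psumr_eq0P => yact.
  apply/eqP; rewrite -subr_eq0; apply/eqP/rigid => k xk.
  have yk : slack y k = 0 by apply: yact => //; rewrite inE xk.
  by have := slackD x (y - x) 1 k; rewrite scale1r addrC subrK yk xk add0r mul1r.
split=> //=; apply/eqP; rewrite -subr_eq0 cE; apply/eqP.
by rewrite big1 // => k /eqP.
Qed.

(** The hypothesis on [w] is that the polyhedron has no non-zero direction of
    recession along which the objective [w] does not increase; it guarantees
    that each move below is stopped by an inequality.  Tight inequalities stay
    tight along a move and the blocking one is added to them, so induction on
    the number of non-tight inequalities terminates. *)
Lemma descend_to_vertex (w : 'cV[R]_s) :
  (forall d : 'rV[R]_s, d != 0 -> (d *m w) 0 0 <= 0 ->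
     exists k, (d *m A) 0 k < 0) ->
  forall x, polyhedron x ->
  exists v, [/\ polyhedron v, vertex polyhedron v & (v *m w) 0 0 <= (x *m w) 0 0].
Proof.
move=> norec x.
have [n] := ubnP #|[pred k | slack x k != 0]|.
elim: n x => // n IHn x lexn Px.
have Px0 := (slack_ge0 x).1 Px.
have [rigid|/existsNP[d0 /not_implyP[d0act /eqP d0neq0]]] :=
    pselect (forall d : 'rV[R]_s,
      (forall k, slack x k = 0 -> (d *m A) 0 k = 0) -> d = 0).
  by exists x; split=> //; exact: vertex_of_rigid.
have [d [dact dneq0 dw]] : exists d : 'rV[R]_s,
    [/\ forall k, slack x k = 0 -> (d *m A) 0 k = 0, d != 0 &
        (d *m w) 0 0 <= 0].
  have [le0|/ltW ge0] := leP ((d0 *m w) 0 0) 0; first by exists d0.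
  exists (- d0); split.
  - by move=> k /d0act dk; rewrite mulNmx mxE dk oppr0.
  - by rewrite oppr_eq0.
  - by rewrite mulNmx mxE oppr_le0.
(* The largest feasible step along [d] is the least ratio of slack to speed
   over the inequalities that [d] brings closer to violation. *)
have [k0 k0lt] := norec d dneq0 dw.
pose ratio k := slack x k / - (d *m A) 0 k.
have [k klt kmin] := @Order.TotalTheory.arg_minP _ R 'I_p k0
  (fun k => (d *m A) 0 k < 0) ratio k0lt.
have t_ge0 : 0 <= ratio k by rewrite divr_ge0 // oppr_ge0 ltW.
pose y := x + ratio k *: d.
have Py : polyhedron y.
  apply/slack_ge0 => j; rewrite slackD.
  have [jge|jlt] := leP 0 ((d *m A) 0 j); first exact: addr_ge0 (Px0 j) (mulr_ge0 t_ge0 jge).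
  by have := kmin j jlt; rewrite /(ratio j) ler_pdivlMr ?oppr_gt0 //; lra.
have yk : slack y k = 0.
  rewrite slackD /ratio; have : (d *m A) 0 k != 0 by rewrite lt_eqF.
  by move=> h; field.
have [|//|v [Pv vv vw]] := IHn y.
  rewrite -ltnS; apply: leq_trans lexn; rewrite ltnS; apply: proper_card.
  apply/properP; split.
    apply/fintype.subsetP => j; rewrite !inE; apply: contraNneq => xj.
    by rewrite slackD xj dact // mulr0 addr0.
  exists k; rewrite !inE ?yk ?eqxx //.
  by apply: contraTneq klt => /dact ->; rewrite ltxx.
exists v; split=> //; apply: le_trans vw _.
have -> : (y *m w) 0 0 = (x *m w) 0 0 + ratio k * (d *m w) 0 0.
  by rewrite mulmxDl -scalemxAl mxE [X in _ + X]mxE.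
by rewrite gerDl mulr_ge0_le0.
Qed.

End Vertices.

(** * Covering polyhedra *)

Section CoveringPolyhedron.
Variables (R : realType) (s m : nat) (C : 'M[rat]_(s, m)).
Hypothesis hC : covering_matrix C.
Local Notation Q := (covering_polyhedron R C).

Lemma covering_polyhedronE :
  Q = polyhedron (row_mx 1%:M (map_mx ratr C)) (row_mx 0 (const_mx 1)).
Proof.
apply/seteqP; split=> x /=.
  move=> [x0 x1] k; rewrite mul_mx_row mulmx1 !mxE.
  by case: split => j; rewrite !mxE //; have := x1 j; rewrite mxE.
move=> h; split=> k.
  by have := h (lshift m k); rewrite mul_mx_row mulmx1 !row_mxEl mxE.
by have := h (rshift s k); rewrite mul_mx_row !row_mxEr mxE.
Qed.

Lemma covering_polyhedron_up (x y : 'rV[R]_s) :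
  (forall i, x 0 i <= y 0 i) -> Q x -> Q y.
Proof.
move=> xy [x0 x1]; split=> [i|j]; first exact: le_trans (xy i).
apply: le_trans (x1 j) _; rewrite !mxE; apply: ler_sum => i _.
by rewrite ler_wpM2r // mxE ler0q; case: hC.
Qed.

(** Each column of [C] has a positive sum [r j], so a constant vector whose
    entry dominates every [1 / r j] satisfies all the covering inequalities. *)
Lemma covering_polyhedron_nonempty : exists x : 'rV[R]_s, Q x.
Proof.
case: hC => C0 C1.
pose r j : R := \sum_i ratr (C i j).
have r_gt0 j : 0 < r j.
  rewrite lt_def sumr_ge0 ?andbT => [|i _]; last by rewrite ler0q.
  apply: contra (C1 j) => /eqP /psumr_eq0P rj.
  apply/eqP/matrixP => i l; rewrite !mxE.
  apply/eqP; rewrite -(fmorph_eq0 (ratr : rat -> R)); apply/eqP/rj => // i' _.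
  by rewrite ler0q.
pose N := \sum_j (r j)^-1.
have N0 : 0 <= N by apply: sumr_ge0 => j _; rewrite invr_ge0 ltW.
exists (const_mx N); split=> [i|j]; first by rewrite mxE.
rewrite mxE.
under eq_bigr do rewrite !mxE.
rewrite -mulr_sumr -/(r j) -ler_pdivrMr // div1r /N (bigD1 j) //= lerDl.
by apply: sumr_ge0 => k _; rewrite invr_ge0 ltW.
Qed.

(** A non-zero direction along which the coordinate sum does not increase has a
    negative coordinate, so it runs into an inequality [0 <= x i]; this is the
    hypothesis of [descend_to_vertex]. *)
Lemma vertex_below (x : 'rV[R]_s) : Q x ->
  exists v, [/\ Q v, vertex Q v & \sum_i v 0 i <= \sum_i x 0 i].
Proof.
have sumE (y : 'rV[R]_s) : (y *m (const_mx 1 : 'cV_s)) 0 0 = \sum_i y 0 i.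
  by rewrite mxE; apply: eq_bigr => i _; rewrite mxE mulr1.
rewrite -!sumE covering_polyhedronE => Qx.
have [|v] := @descend_to_vertex _ _ _ _ _ (const_mx 1) _ x Qx; last first.
  by rewrite !sumE => h; exists v.
move=> d dneq0; rewrite sumE => dle0.
have [i di] : exists i, d 0 i < 0.
  apply: contrapT => /forallNP h; move/negP: dneq0; apply.
  have d_ge0 i : 0 <= d 0 i by rewrite leNgt; apply/negP/h.
  have d_sum : \sum_i d 0 i = 0 by apply/eqP; rewrite eq_le dle0 sumr_ge0.
  apply/eqP/rowP => i; rewrite [RHS]mxE.
  by move/psumr_eq0P: d_sum; apply.
by exists (lshift m i); rewrite mul_mx_row mulmx1 row_mxEl.
Qed.

Definition lp_value : R := inf [set \sum_i x 0 i | x in Q]%classic.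

Lemma lp_value_has_inf : has_inf [set \sum_i x 0 i | x in Q]%classic.
Proof.
split; first by have [x Qx] := covering_polyhedron_nonempty; exists (\sum_i x 0 i), x.
by exists 0 => _ [x [x0 _] <-]; exact: sumr_ge0.
Qed.

Lemma lp_value_le (x : 'rV[R]_s) : Q x -> lp_value <= \sum_i x 0 i.
Proof. by move=> Qx; apply: ge_inf; [case: lp_value_has_inf|exists x]. Qed.

End CoveringPolyhedron.

(** * Least degree of a monomial *)

Section Alpha.
Variables (K : fieldType) (s : nat).

(** One monomial in [I n] is enough to rule out the default value of [alpha]. *)
Lemma alphaP (I : nat -> set (mpoly s K)) n a0 : I n (mpolyX K a0) ->
  (exists2 a, I n (mpolyX K a) & mdeg a = alpha I n) /\
  (forall a, I n (mpolyX K a) -> (alpha I n <= mdeg a)%N).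
Proof.
move=> Ia0; rewrite /alpha.
set degrees : set nat := [set mdeg a | a in _]%classic.
case: (@xgetPex _ 0%N
    [set d | degrees d /\ forall d', degrees d' -> (d <= d')%N]%classic) => /=.
  have exd : exists d, `[< degrees d >] by exists (mdeg a0); apply/asboolP; exists a0.
  have [d /asboolP dd dmin] := ex_minnP exd.
  by exists d; split=> // d' dd'; apply: dmin; apply/asboolP.
move=> [a Ia adeg] amin; split; first by exists a.
by move=> a' Ia'; apply: amin; exists a'.
Qed.

End Alpha.

(** * The filtration and its Waldschmidt constant *)

Section Waldschmidt.
Variables (R : realType) (K : fieldType) (s m : nat) (C : 'M[rat]_(s, m)).
Hypothesis hC : covering_matrix C.
Local Notation Q := (covering_polyhedron R C).
Local Notation F := (filtration K R C).

Definition scaled_exponent (n : nat) (a : multinom s) : 'rV[R]_s :=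
  \row_i ((a i)%:R / n%:R).

Lemma sum_scaled_exponent n a :
  \sum_i scaled_exponent n a 0 i = (mdeg a)%:R / n%:R.
Proof.
by rewrite mdegE natr_sum mulr_suml; apply: eq_bigr => i _; rewrite mxE.
Qed.

(** The polynomials all of whose exponents [c] satisfy [c / n \in Q] form an
    ideal, because multiplication only raises exponents and [Q] is closed
    upwards.  It contains the generators of [I_n], hence [I_n]. *)
Lemma filtration_monomial n a : (0 < n)%N ->
  F n (mpolyX K a) <-> Q (scaled_exponent n a).
Proof.
case: n => // n _; split; last by move=> Qa; apply: sub_gen_smallest; exists a.
pose J : set (mpoly s K) :=
  [set f | forall c, c \in msupp f -> Q (scaled_exponent n.+1 c)]%classic.
suff Jideal : is_ideal J.
  move=> /(smallest_sub Jideal) Fa; apply: (Fa); last by apply/mem_msuppXP.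
  by move=> _ [c /= Qc <-] c' /mem_msuppXP <-.
split=> [c|f g Jf Jg c|h f Jf c]; first by rewrite msupp0.
  by move=> /msuppD_le; rewrite mem_cat => /orP[/Jf|/Jg].
move=> /msuppM_le /allpairsP[[c1 c2] /= [_ /Jf Qc2 ->]].
apply: covering_polyhedron_up Qc2 => // i.
by rewrite !mxE ler_wpM2r ?invr_ge0 // ler_nat mnmDE leq_addl.
Qed.


(** The successor of the integer part is used instead of the ceiling: it exceeds
    [n x i] by at most one, all that the limit needs. *)
Definition round_up n (x : 'rV[R]_s) : multinom s :=
  Multinom [tuple (Num.truncn (n%:R * x 0 i)).+1 | i < s].

Lemma round_up_mem n x : (0 < n)%N -> Q x -> F n (mpolyX K (round_up n x)).
Proof.
move=> n0 Qx; apply/filtration_monomial => //.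
apply: covering_polyhedron_up Qx => // i.
by rewrite mxE mnmE ler_pdivlMr ?ltr0n // mulrC ltW // truncnS_gt.
Qed.

Lemma mdeg_round_up n x : Q x ->
  (mdeg (round_up n x))%:R <= n%:R * \sum_i x 0 i + s%:R :> R.
Proof.
move=> [x0 _]; rewrite mdegE natr_sum mulr_sumr.
have -> : s%:R = \sum_(i < s) 1 :> R by rewrite sumr_const card_ord.
rewrite -big_split; apply: ler_sum => i _.
by rewrite mnmE -natr1 lerD2r truncn_le mulr_ge0.
Qed.

Lemma alphaF n : (0 < n)%N ->
  (exists2 a, Q (scaled_exponent n a) & mdeg a = alpha F n) /\
  (forall a, Q (scaled_exponent n a) -> (alpha F n <= mdeg a)%N).
Proof.
move=> n0; have [x Qx] := covering_polyhedron_nonempty R hC.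
have [[a Fa aE] amin] := alphaP (round_up_mem n0 Qx).
split=> [|c /filtration_monomial Fc]; last exact/amin/Fc.
by exists a => //; apply/filtration_monomial.
Qed.

Lemma lp_value_le_alpha n : (0 < n)%N -> lp_value R C <= (alpha F n)%:R / n%:R.
Proof.
move=> n0; have [[a Qa <-] _] := alphaF n0.
by rewrite -sum_scaled_exponent; apply: lp_value_le.
Qed.

(** Given [e], choose [x] in [Q] with [|x| < lp_value + e / 2]; for [n] with
    [s / n <= e / 2], rounding up [n x] puts [alpha n / n] between [lp_value]
    and [lp_value + e]. *)
Lemma waldschmidtE : waldschmidt R F = lp_value R C.
Proof.
apply: cvg_lim; first exact: Rhausdorff.
apply/cvgrPdist_le => e e0.
have e20 : 0 < e / 2 by rewrite divr_gt0.
have [_ [x Qx <-] xlt] := inf_adherent e20 (lp_value_has_inf R hC).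
near=> n.
have n0 : (0 < n)%N by near: n; exact: nbhs_infty_gt.
have nR : 0 < n%:R :> R by rewrite ltr0n.
have se : s%:R / n%:R <= e / 2.
  rewrite ler_pdivrMr // mulrC -ler_pdivrMr //.
  by near: n; exact: nbhs_infty_ger.
rewrite distrC ger0_norm ?subr_ge0 ?lp_value_le_alpha //.
have [_ /(_ (round_up n x)) amin] := alphaF n0.
have : (alpha F n)%:R / n%:R <= \sum_i x 0 i + s%:R / n%:R.
  rewrite ler_pdivrMr // mulrDl divfK ?gt_eqF // [_ * n%:R]mulrC.
  apply: le_trans (mdeg_round_up n Qx); rewrite ler_nat; apply: amin.
  exact/filtration_monomial/round_up_mem.
by move: xlt; rewrite -/(lp_value R C); lra.
Unshelve. all: by end_near.
Qed.

Lemma alpha1_le_vertex v : Q v -> (forall i, v 0 i \is a Num.int) ->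
  (alpha F 1)%:R <= \sum_i v 0 i.
Proof.
move=> Qv vint; pose a : multinom s := Multinom [tuple Num.truncn (v 0 i) | i < s].
have aE : scaled_exponent 1 a = v.
  apply/rowP => i; rewrite mxE mnmE divr1 truncnK //.
  by rewrite -intrEge0 //; case: Qv.
have [_ /(_ a)] := alphaF (ltn0Sn 0).
rewrite aE => /(_ Qv); rewrite -(ler_nat R) => /le_trans; apply.
by rewrite -aE sum_scaled_exponent divr1.
Qed.

End Waldschmidt.

Theorem proposition3p6 (R : realType) (K : fieldType) (s m : nat)
    (C : 'M[rat]_(s, m)) (hC : covering_matrix C) :
  let F := filtration K R C in
  (alpha F 1)%:R >= waldschmidt R F /\
  (integral_polyhedron (covering_polyhedron R C) ->
   (alpha F 1)%:R = waldschmidt R F).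
Proof.
move=> F; rewrite waldschmidtE //.
have le1 : lp_value R C <= (alpha F 1)%:R.
  by have := lp_value_le_alpha R K hC (ltn0Sn 0); rewrite divr1.
split=> // Qint; apply/eqP; rewrite eq_le le1 andbT.
apply: lb_le_inf; first by case: (lp_value_has_inf R hC).
move=> _ [x Qx <-]; have [v [Qv vv vx]] := vertex_below Qx.
by apply: le_trans vx; apply: alpha1_le_vertex => //; exact: Qint.
Qed.
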